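(* Let $\mathcal{I}$ be an upward directed set which is also a D-index set, with zero $0_{\mathcal{I}}$. Suppose that $\mathbf{d}$ is a coarse $\mathcal{I}$-metric on a set $X$. If there exists $\Phi:\mathcal{I}\to\mathcal{I}$ satisfying $\mathbf{D}_\alpha\circ\mathbf{D}_\alpha\subseteq\mathbf{D}_{\Phi(\alpha)}$ for all $\alpha\in\mathcal{I}$ and such that $\Phi(\mathcal{I}\setminus\{0_{\mathcal{I}}\})$ is a downward cofinal subset of $\mathcal{I}\setminus\{0_{\mathcal{I}}\}$, then $\mathbf{d}$ is also a pseudo uniform $\mathcal{I}$-metric.
   Context: For $A,B\subseteq X\times X$, $A\circ B=\{(x,z):\exists y\in X,\ (x,y)\in A,\ (y,z)\in B\}$. A partially ordered set is upward directed if any two elements have an upper bound in it. A D-index set is a partially ordered set $\mathcal{I}$ with a smallest element (zero) $0_{\mathcal{I}}$ such that $\mathcal{I}\setminus\{0_{\mathcal{I}}\}$ is non-empty and downward directed (any two elements have a common lower bound in it). A subset $\mathcal{S}$ of a partially ordered set $\mathcal{K}$ is downward cofinal if for every $\alpha\in\mathcal{K}$ there exists $\beta\in\mathcal{S}$ with $\beta\le\alpha$. $\mathcal{I}_\infty$ is $\mathcal{I}$ with a new element $\infty$ adjoined that is strictly larger than all elements of $\mathcal{I}$. For $\mathbf{d}:X\times X\to\mathcal{I}_\infty$ and $\alpha\in\mathcal{I}$, $\mathbf{D}_\alpha=\{(x,y)\in X\times X:\mathbf{d}(x,y)\le\alpha\}$. $\mathbf{d}$ is a semi-$\mathcal{I}$-metric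 if $\mathbf{d}(x,x)=0_{\mathcal{I}}$ and $\mathbf{d}(x,y)=\mathbf{d}(y,x)$ for all $x,y\in X$. A semi-$\mathcal{I}$-metric is a coarse $\mathcal{I}$-metric if there is $\Phi:\mathcal{I}\to\mathcal{I}$ with $\mathbf{D}_\alpha\circ\mathbf{D}_\alpha\subseteq\mathbf{D}_{\Phi(\alpha)}$ for all $\alpha\in\mathcal{I}$; it is a pseudo uniform $\mathcal{I}$-metric if there is $\Psi:\mathcal{I}\setminus\{0_{\mathcal{I}}\}\to\mathcal{I}\setminus\{0_{\mathcal{I}}\}$ with $\mathbf{D}_{\Psi(\beta)}\circ\mathbf{D}_{\Psi(\beta)}\subseteq\mathbf{D}_\beta$ for all $\beta\in\mathcal{I}\setminus\{0_{\mathcal{I}}\}$. *)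

(* Defs.v *)
From HB Require Import structures.
From mathcomp Require Import all_boot all_order.
From mathcomp Require Import boolp classical_sets.

Set Implicit Arguments.
Unset Strict Implicit.
Unset Printing Implicit Defensive.

Import Order.TTheory.
Local Open Scope order_scope.
Local Open Scope classical_set_scope.

Section AdjoinInfty.
Context {disp : Order.disp_t} (I : porderType disp).

(* [Some a] is the element [a] of [I]; [None] is the new element oo. *)
Definition adjoin_infty : Type := option I.

HB.instance Definition _ := Choice.on adjoin_infty.

Definition infty : adjoin_infty := None.

Definition le_infty (x y : adjoin_infty) : bool :=
  match x, y with
  | _, None => true
  | None, Some _ => false
  | Some a, Some b => a <= b
  end.

Lemma le_infty_refl : reflexive le_infty.
Proof. by case=> //= a; rewrite lexx. Qed.

Lemma le_infty_anti : antisymmetric le_infty.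
Proof. by case=> [a|] [b|] //= /le_anti ->. Qed.

Lemma le_infty_trans : transitive le_infty.
Proof. by case=> [b|] [a|] [c|] //=; apply: le_trans. Qed.

HB.instance Definition _ := Order.Le_isPOrder.Build disp adjoin_infty
  le_infty_refl le_infty_anti le_infty_trans.

Lemma le_Some (a b : I) : (Some a <= Some b :> adjoin_infty) = (a <= b).
Proof. by []. Qed.

Lemma lt_Some_infty (a : I) : (Some a : adjoin_infty) < infty.
Proof. by rewrite lt_neqAle. Qed.

End AdjoinInfty.

Section Directed.
Context {disp : Order.disp_t} {T : porderType disp}.

Definition upward_directed (A : set T) : Prop :=
  forall x y, A x -> A y -> exists2 z, A z & (x <= z) /\ (y <= z).

Definition downward_directed (A : set T) : Prop :=
  forall x y, A x -> A y -> exists2 z, A z & (z <= x) /\ (z <= y).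

Definition downward_cofinal (S K : set T) : Prop :=
  S `<=` K /\ forall a, K a -> exists2 b, S b & b <= a.

End Directed.

Definition nonzero {disp : Order.disp_t} (I : bPOrderType disp) : set I :=
  [set a | a != \bot].
Arguments nonzero {disp} I.

(* The zero is the [\bot] of the [bPOrderType] structure. *)
Definition D_index_set {disp : Order.disp_t} (I : bPOrderType disp) : Prop :=
  nonzero I !=set0 /\ downward_directed (nonzero I).

Section Metrics.
Context {disp : Order.disp_t} {I : bPOrderType disp} {X : Type}.
Variable d : X -> X -> adjoin_infty I.

Definition Dset (a : I) : set (X * X) := [set p | d p.1 p.2 <= Some a].

Definition semi_metric : Prop :=
  (forall x, d x x = Some \bot) /\ (forall x y, d x y = d y x).

(* [A \; B] is [set (x, z) | exists y, A (x, y) & B (y, z)]. *)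
Definition coarse_metric : Prop :=
  semi_metric /\
  exists Phi : I -> I,
    forall a : I, (Dset a \; Dset a)%relation `<=` Dset (Phi a).

Definition pseudo_uniform_metric : Prop :=
  semi_metric /\
  exists Psi : nonzero I -> nonzero I,
    forall b : nonzero I,
      (Dset (\val (Psi b)) \; Dset (\val (Psi b)))%relation `<=` Dset (\val b).

End Metrics.

(* Main.v *)
Require Import Defs.
From HB Require Import structures.
From mathcomp Require Import all_boot all_order.
From mathcomp Require Import boolp classical_sets.

Import Order.TTheory.
Local Open Scope order_scope.
Local Open Scope classical_set_scope.

(** The two kinds of metric read the same inclusion [D_a \; D_a] in [D_(Phi a)]
    in opposite directions: the coarse one prescribes the radius [a] of the
    factors, the uniform one the radius [b] of a set containing the composite.
    Cofinality of the image of [Phi] turns one into the other, since it gives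
    for every nonzero [b] some nonzero [a] with [Phi a <= b]. Choosing such an
    [a] for each [b] defines [Psi], a right inverse of [Phi] up to [<=], and
    [Dset_mono] enlarges [D_(Phi a)] to [D_b]. *)

Lemma Dset_mono (disp : Order.disp_t) (I : bPOrderType disp) (X : Type)
    (d : X -> X -> adjoin_infty I) (a b : I) :
  a <= b -> Dset d a `<=` Dset d b.
Proof. by move=> leab p /le_trans; apply; rewrite le_Some. Qed.

Theorem proposition19 (disp : Order.disp_t) (I : bPOrderType disp)
    (hup : upward_directed [set: I]) (hD : D_index_set I)
    (X : Type) (d : X -> X -> adjoin_infty I) (hd : coarse_metric d)
    (hPhi : exists Phi : I -> I,
      (forall a : I, (Dset d a \; Dset d a)%relation `<=` Dset d (Phi a)) /\
      downward_cofinal (Phi @` nonzero I) (nonzero I)) :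
  pseudo_uniform_metric d.
Proof.
case: hd => semi _; case: hPhi => Phi [compPhi [_ cofPhi]]; split=> //.
have exPsi (b : nonzero I) : exists a : nonzero I, Phi (\val a) <= \val b.
  have [_ [a a0 <-] leab] := cofPhi _ (set_valP b).
  by exists (SigSub (mem_set a0)).
have [Psi lePsi] := choice exPsi.
by exists Psi => b p /compPhi; apply: Dset_mono.
Qed.
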